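(* Let $n \geq 1$, $r \geq 2$ and $k \geq 1$ be integers. Then \[ \mathrm{ex}(n,P_k^r) \leq \begin{cases} \frac{k-1}{2}\binom{n}{r-1} & \text{if } r \text{ is even},\\[2pt] \frac{1}{2}\left(k + \left\lfloor \frac{k-1}{r}\right\rfloor\right)\binom{n}{r-1} & \text{if } r \text{ is odd}. \end{cases}\]
   Context: An $r$-graph is an $r$-uniform hypergraph. For $k \geq 1$ and $r \geq 2$, a tight $k$-path $P_k^r$ is the $r$-graph on distinct vertices $v_0, v_1, \dots, v_{k+r-2}$ with edge set $\{\{v_i, v_{i+1}, \dots, v_{i+r-1}\} : 0 \leq i < k\}$. $\mathrm{ex}(n,P_k^r)$ denotes the maximum number of edges in an $n$-vertex $r$-graph that contains no tight $k$-path (as a subhypergraph). *)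

(* Defs.v *)
From mathcomp Require Import all_boot all_order all_algebra.

Set Implicit Arguments.
Unset Strict Implicit.
Unset Printing Implicit Defensive.

Definition uniform (V : finType) (r : nat) (H : {set {set V}}) : bool :=
  [forall e in H, #|e| == r].

(* Not necessarily induced copies: only edges of F have to be mapped to edges. *)
Definition contains_copy (U V : finType) (F : {set {set U}})
    (H : {set {set V}}) : bool :=
  [exists f : {ffun U -> V}, injectiveb f && [forall e in F, f @: e \in H]].

Definition turan_ex (n r : nat) (U : finType) (F : {set {set U}}) : nat :=
  \max_(H : {set {set 'I_n}} | uniform r H && ~~ contains_copy F H) #|H|.

(* The vertex v_j is represented by j : 'I_(k + r - 1). *)
Definition tight_path (k r : nat) : {set {set 'I_(k + r - 1)}} :=
  [set [set j : 'I_(k + r - 1) | i <= j < i + r] | i : 'I_k].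

(* Main.v *)
Require Import Defs.
From mathcomp Require Import all_boot all_order all_algebra.
From mathcomp Require Import zify ring.

Set Implicit Arguments.
Unset Strict Implicit.
Unset Printing Implicit Defensive.

Import GRing.Theory Num.Theory Order.TTheory.

(** Write a tight path in [r] slots, its vertex [v_q] sitting in slot
    [q mod r]: passing from an edge to the next one replaces the vertex of a
    single slot.  Pair slot [2j] with slot [2j+1] (the last slot is alone when
    [r] is odd) and give every vertex a color in ['I_r], which says which pair
    of slots it may occupy.  The two vertices of a pair bound an arc of the
    cyclic order on the vertices, and we only replace one of them by a vertex
    inside that arc, so that the arcs shrink and no vertex is ever reused; a
    lone slot only moves upwards.

    Follow all orderings of edges that respect the coloring simultaneously,
    moving slot [t mod r] at time [t].  Of two orderings that differ only in the
    moving slot, one can be reached from the other, so at most one ordering is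
    lost for each way of filling the other [r - 1] slots.  Without a tight
    [k]-path, everything is lost after [k - 1] steps.  Averaging over all
    colorings gives [|H| <= 'C(n, r - 1) * \sum_(t < k - 1) 1 / w (t mod r)],
    where [w s] is the number of slots in the pair of [s]: 2, or 1 for a lone
    slot. *)

Lemma inZp_neq (m i q : nat) : i < q <= i + m -> inZp q != inZp i :> 'I_m.+1.
Proof.
case/andP=> lt_iq le_qim; rewrite -val_eqE /= -(subnKC (ltnW lt_iq)).
by rewrite -[X in _ != X %% _]addn0 eqn_modDl mod0n modn_small; lia.
Qed.

Lemma imset_inZp_shift (m i : nat) :
  [set (inZp (i + j) : 'I_m.+1) | j : 'I_m.+1] = setT.
Proof.
have shift_inj : injective (fun j : 'I_m.+1 => inZp (i + j) : 'I_m.+1).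
  move=> j j' /(congr1 val)/eqP /=.
  by rewrite eqn_modDl !modn_small // => /eqP /ord_inj.
by apply/eqP; rewrite eqEcard subsetT cardsT /= card_imset.
Qed.

Lemma contains_tight_path (V : finType) (H : {set {set V}}) (k r : nat)
    (p : nat -> V) :
  {in gtn (k + r - 1) &, injective p} ->
  (forall i, i < k -> [set p (i + j) | j : 'I_r] \in H) ->
  contains_copy (tight_path k r) H.
Proof.
move=> p_inj windowH; apply/existsP.
exists [ffun j : 'I_(k + r - 1) => p j]; apply/andP; split.
  apply/injectiveP => i j; rewrite !ffunE => eq_p; apply: val_inj.
  by apply: p_inj eq_p; rewrite inE /=.
apply/forall_inP => _ /imsetP[i _ ->].
suff -> : [ffun j : 'I_(k + r - 1) => p j] @:
    [set j : 'I_(k + r - 1) | i <= j < i + r] = [set p (i + j) | j : 'I_r].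
  exact: windowH.
apply/setP => v; apply/imsetP/imsetP => -[j].
  rewrite inE => /andP[le_ij lt_jir] ->; have lt_jr : j - i < r by lia.
  by exists (Ordinal lt_jr); rewrite // ffunE /= subnKC.
move=> _ ->; have lt_ij : i + j < k + r - 1.
  by have := ltn_ord i; have := ltn_ord j; lia.
by exists (Ordinal lt_ij); rewrite ?ffunE ?inE //= leq_addr ltn_add2l /=.
Qed.

Lemma uniform_eq0 (V : finType) (r : nat) (H : {set {set V}}) :
  uniform r H -> #|V| < r -> H = set0.
Proof.
move/forall_inP=> Hr ltVr; apply/setP => e; rewrite inE; apply/negP => /Hr.
by have := max_card e; lia.
Qed.

Definition injections (I V : finType) : {set {ffun I -> V}} :=
  [set x : {ffun I -> V} | injectiveb x].

Definition edge_orderings (V : finType) (r : nat) (H : {set {set V}}) :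
  {set {ffun 'I_r -> V}} := [set x in injections 'I_r V | x @: setT \in H].

Lemma card_edge_orderings (V : finType) (r : nat) (H : {set {set V}}) :
  uniform r H -> #|edge_orderings r H| = #|H| * r`!.
Proof.
move/forall_inP => Hr.
pose edge_of (x : {ffun 'I_r -> V}) := x @: setT.
rewrite -sum1_card (partition_big edge_of (mem H)) /=; last first.
  by move=> x; rewrite inE => /andP[].
rewrite -sum_nat_const; apply: eq_bigr => e eH.
have /eqP card_e := Hr e eH.
have := card_inj_ffuns_on 'I_r (mem e); rewrite card_e card_ord ffactnn => <-.
rewrite sum1dep_card; apply: eq_card => x; rewrite !inE.
apply/idP/andP => [/andP[/andP[x_inj _] /eqP <-]|[/ffun_onP xe x_inj]].
  by split=> //; apply/ffun_onP => i; rewrite imset_f.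
have edge_x : x @: setT = e.
  apply/eqP; rewrite eqEcard card_e card_imset; last exact/injectiveP.
  rewrite cardsT card_ord leqnn andbT.
  by apply/subsetP => _ /imsetP[i _ ->]; apply: xe.
by rewrite /edge_of edge_x x_inj eH eqxx.
Qed.

Lemma card_ffun_constrained (I V C : finType) (x : I -> V) (P : I -> pred C) :
  injective x ->
  #|[set c : {ffun V -> C} | [forall i, P i (c (x i))]]|
    = (\prod_i #|P i|) * #|C| ^ (#|V| - #|I|).
Proof.
move=> x_inj.
pose allowed v : pred C := [pred a | [forall i, (x i == v) ==> P i a]].
have -> : #|[set c : {ffun V -> C} | [forall i, P i (c (x i))]]|
        = #|(family allowed : {pred {ffun V -> C}})|.
  rewrite cardsE; apply: eq_card => c; apply/forallP/familyP => [Pc v|Pc i].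
    by apply/forallP => i; apply/implyP => /eqP <-.
  by have /forallP/(_ i) := Pc (x i); rewrite eqxx.
rewrite card_family foldrE big_image /= (bigID (mem (x @: setT))) /=.
congr (_ * _).
  rewrite big_imset /=; last by move=> ? ? _ _; apply: x_inj.
  apply: eq_big => [i|i _]; first by rewrite inE.
  apply: eq_card => a; apply/forallP/idP => [/(_ i)|Pa j].
    by rewrite eqxx.
  by apply/implyP => /eqP/x_inj ->.
rewrite (eq_bigr (fun=> #|C|)); last first.
  move=> v v_free; apply: eq_card => a; rewrite !inE.
  apply/forallP => i; apply/implyP => /eqP xi_v.
  by case/negP: v_free; rewrite -xi_v imset_f.
rewrite prod_nat_const; congr (_ ^ _).
rewrite -[X in _ = _ - X]cardsT -(card_imset setT x_inj).
by rewrite -(cardsC (x @: setT)) addKn; apply: eq_card => v; rewrite !inE.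
Qed.

Lemma double_counting (S T : finType) (X : {set T}) (Q : S -> T -> bool) :
  \sum_a #|[set x in X | Q a x]| = \sum_(x in X) #|[set a | Q a x]|.
Proof.
under eq_bigr => a _ do rewrite -sum1dep_card big_mkcondr.
rewrite exchange_big; apply: eq_bigr => x _.
by rewrite -sum1dep_card -big_mkcond.
Qed.

Lemma sum_card_constrained (I V C : finType) (X : {set {ffun I -> V}})
    (P : I -> pred C) :
  X \subset injections I V ->
  \sum_(c : {ffun V -> C}) #|[set x in X | [forall i, P i (c (x i))]]|
    = #|X| * ((\prod_i #|P i|) * #|C| ^ (#|V| - #|I|)).
Proof.
move/subsetP=> X_inj; rewrite -sum_nat_const.
rewrite (double_counting X
  (fun (c : {ffun V -> C}) x => [forall i, P i (c (x i))])).
apply: eq_bigr => x /X_inj; rewrite inE => /injectiveP.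
exact: card_ffun_constrained.
Qed.

Section DropSlot.
Variables (V : finType) (m : nat).
Implicit Types (x y : {ffun 'I_m.+1 -> V}) (s : 'I_m.+1).

Definition drop_slot s x : {ffun 'I_m -> V} := [ffun i => x (lift s i)].

Lemma eq_drop_slotP s x y :
  reflect {in predC1 s, x =1 y} (drop_slot s x == drop_slot s y).
Proof.
apply: (iffP eqP) => [/ffunP eq_xy i|eq_xy]; last first.
  by apply/ffunP => i; rewrite !ffunE eq_xy // inE eq_sym neq_lift.
rewrite inE; case: (unliftP s i) => [j ->|->]; last by rewrite eqxx.
by have := eq_xy j; rewrite !ffunE.
Qed.

End DropSlot.

(** [region x s] is the set of vertices that slot [s] of the ordering [x] may
    still move to; slots of the same kind share their region. *)
Record shrinking_regions (V : finType) (m : nat) (K : eqType)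
    (kind : 'I_m.+1 -> K)
    (region : {ffun 'I_m.+1 -> V} -> 'I_m.+1 -> pred V) : Prop := {
  region_self x s : ~~ region x s (x s);
  region_kind x s s' : kind s = kind s' -> region x s =1 region x s';
  region_shrink (x y : {ffun 'I_m.+1 -> V}) s s' :
    {in predC1 s, x =1 y} -> region x s (y s) ->
    subpred (region y s') (region x s');
  region_total (x y : {ffun 'I_m.+1 -> V}) s :
    injective x -> injective y -> {in predC1 s, x =1 y} -> x s != y s ->
    region x s (y s) || region y s (x s)
}.

Section Regions.
Variables (V : finType) (m : nat) (K : eqType) (kind : 'I_m.+1 -> K).
Variable region : {ffun 'I_m.+1 -> V} -> 'I_m.+1 -> pred V.
Hypothesis regionP : shrinking_regions kind region.
Variable H : {set {set V}}.
Implicit Types (c : {ffun V -> 'I_m.+1}) (x y : {ffun 'I_m.+1 -> V}).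

Definition colored_orderings c : {set {ffun 'I_m.+1 -> V}} :=
  [set x in edge_orderings m.+1 H | [forall s, kind (c (x s)) == kind s]].

Definition colored_partial_orderings c (s : 'I_m.+1) : {set {ffun 'I_m -> V}} :=
  [set y in injections 'I_m V | [forall i, kind (c (y i)) == kind (lift s i)]].

Lemma colored_orderingsP c x :
  reflect [/\ injective x, x @: setT \in H & forall s, kind (c (x s)) = kind s]
          (x \in colored_orderings c).
Proof.
rewrite !inE -andbA; apply: (iffP and3P) => -[x_inj xH cx]; split=> //.
- exact/injectiveP.
- by move=> s; apply/eqP/(forallP cx).
- exact/injectiveP.
- by apply/forallP => s; apply/eqP.
Qed.

Definition moves (s : 'I_m.+1) x y : bool :=
  (drop_slot s x == drop_slot s y) && region x s (y s).

Definition walk c (X : nat -> {ffun 'I_m.+1 -> V}) (t : nat) : Prop :=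
  (forall i, i <= t -> X i \in colored_orderings c) /\
  (forall i, i < t -> moves (inZp i) (X i) (X i.+1)).

(* The first [m.+1] vertices all come from [X 0], since [q - m] is truncated;
   afterwards, [X (q - m)] is the ordering in which slot [inZp q] has just
   moved. *)
Definition walk_vertex (X : nat -> {ffun 'I_m.+1 -> V}) (q : nat) : V :=
  X (q - m) (inZp q).

Section Walk.
Variables (c : {ffun V -> 'I_m.+1}) (X : nat -> {ffun 'I_m.+1 -> V}) (t : nat).
Hypothesis walkX : walk c X t.

Lemma walk_stationary (q i : nat) :
  q - m <= i <= q -> i <= t -> X i (inZp q) = walk_vertex X q.
Proof.
case/andP=> /subnKC <-; elim: (i - _) => [|d IHd]; first by rewrite addn0.
rewrite addnS => lt_q lt_t; rewrite -IHd ?(ltnW lt_t) ?(ltnW lt_q) //.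
have /andP[/eq_drop_slotP -> //] := walkX.2 _ lt_t.
by rewrite inE inZp_neq //; lia.
Qed.

Lemma walk_avoids_vertex (q i : nat) :
  q - m <= i -> i <= t -> ~~ region (X i) (inZp q) (walk_vertex X q).
Proof.
move/subnKC <-; elim: (i - _) => [|d IHd].
  by move=> _; rewrite addn0 (region_self regionP).
rewrite addnS => lt_t; have /andP[/eq_drop_slotP agree moved] := walkX.2 _ lt_t.
apply: contra (IHd (ltnW lt_t)); exact: (region_shrink regionP agree moved).
Qed.

Lemma kind_walk_vertex (q : nat) :
  q < t + m.+1 -> kind (c (walk_vertex X q)) = kind (inZp q).
Proof.
move=> lt_q; have le_t : q - m <= t by lia.
by have /colored_orderingsP[_ _ ->] := walkX.1 _ le_t.
Qed.

Lemma walk_vertex_neq (q q' : nat) :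
  q < q' < t + m.+1 -> walk_vertex X q != walk_vertex X q'.
Proof.
case/andP=> lt_qq' lt_q'; apply/eqP => eq_vertex.
have [le_q'm|lt_mq'] := leqP q' m.
  have /colored_orderingsP[X0_inj _ _] := walkX.1 _ (leq0n t).
  move: eq_vertex; rewrite /walk_vertex; have -> : q - m = 0 by lia.
  have -> : q' - m = 0 by lia.
  by move/X0_inj/(congr1 val); rewrite /= !modn_small; lia.
(* Slot [q'] moves to the vertex [q'] from [X i], inside a region that vertex
   [q] avoids, the two slots being of the same kind. *)
have eq_kind : kind (inZp q) = kind (inZp q').
  by rewrite -!kind_walk_vertex ?eq_vertex //; lia.
pose i := q' - m.+1; have lt_it : i < t by lia.
have slot_i : inZp i = inZp q' :> 'I_m.+1.
  by apply: val_inj; rewrite /= -(subnK lt_mq') modnDr.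
have /andP[_] := walkX.2 _ lt_it; rewrite slot_i.
rewrite walk_stationary //; last by lia.
rewrite -(region_kind regionP _ eq_kind) -eq_vertex.
by apply/negP; apply: walk_avoids_vertex; lia.
Qed.

Lemma walk_vertex_inj : {in gtn (t + m.+1) &, injective (walk_vertex X)}.
Proof.
move=> q q' lt_q lt_q' eq_vertex.
have [lt_qq'|lt_q'q|//] := ltngtP q q'.
  by have := @walk_vertex_neq q q'; rewrite lt_qq' eq_vertex eqxx => /(_ lt_q').
by have := @walk_vertex_neq q' q; rewrite lt_q'q eq_vertex eqxx => /(_ lt_q).
Qed.

Lemma walk_vertex_window (i : nat) :
  i <= t -> [set walk_vertex X (i + j) | j : 'I_m.+1] = X i @: setT.
Proof.
move=> le_it; rewrite -(imset_inZp_shift m i) -imset_comp.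
apply: eq_imset => j /=; rewrite walk_stationary //.
by have := ltn_ord j; lia.
Qed.

Lemma walk_contains_copy : contains_copy (tight_path t.+1 m.+1) H.
Proof.
apply: (@contains_tight_path _ _ _ _ (walk_vertex X)) => [|i le_it].
  by rewrite addSn subn1; apply: walk_vertex_inj.
rewrite walk_vertex_window //.
by have /colored_orderingsP[] := walkX.1 i le_it.
Qed.

End Walk.

Fixpoint walk_ends c (t : nat) : {set {ffun 'I_m.+1 -> V}} :=
  if t isn't t'.+1 then colored_orderings c else
  [set y in colored_orderings c |
    [exists x in walk_ends c t', moves (inZp t') x y]].

Lemma walk_ends_sub c t : walk_ends c t \subset colored_orderings c.
Proof. by case: t => //= t; apply/subsetP => x /[!inE] /andP[]. Qed.

Lemma walk_endsP c t x :
  x \in walk_ends c t -> exists2 X, walk c X t & X t = x.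
Proof.
elim: t x => [|t IHt] y /=.
  by move=> y_col; exists (fun=> y) => //; split=> // i; rewrite leqn0.
rewrite inE => /andP[y_col /exists_inP[x /IHt[X [X_col X_moves] Xt] move_xy]].
exists (fun i => if i <= t then X i else y); last by rewrite ltnn.
split=> i; first by case: ifP => // le_it _; apply: X_col.
move=> lt_i; have [lt_it|le_ti] := ltnP i t.
  by rewrite (ltnW lt_it); apply: X_moves.
have -> : i = t by lia.
by rewrite leqnn Xt.
Qed.

Lemma drop_slot_lost_inj c t :
  {in walk_ends c t :\: walk_ends c t.+1 &, injective (drop_slot (inZp t))}.
Proof.
set s := inZp t => x y /setDP[xt x_lost] /setDP[yt y_lost] eq_drop.
have stuck u v : u \in walk_ends c t -> v \in walk_ends c t ->
    v \notin walk_ends c t.+1 -> drop_slot s u = drop_slot s v ->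
    ~~ region u s (v s).
  move=> ut vt v_lost eq_uv; apply: contra v_lost => moved /=.
  rewrite inE (subsetP (walk_ends_sub c t)) //=.
  by apply/exists_inP; exists u => //; rewrite /moves eq_uv eqxx.
have /colored_orderingsP[x_inj _ _] := subsetP (walk_ends_sub c t) x xt.
have /colored_orderingsP[y_inj _ _] := subsetP (walk_ends_sub c t) y yt.
have agree : {in predC1 s, x =1 y} by apply/eq_drop_slotP/eqP.
have [eq_s|neq_s] := eqVneq (x s) (y s).
  by apply/ffunP => i; have [->|/agree] := eqVneq i s.
have := region_total regionP x_inj y_inj agree neq_s.
by rewrite (negPf (stuck x y _ _ _ _)) // (negPf (stuck y x _ _ _ _)).
Qed.

Lemma card_walk_ends_step c t :
  #|walk_ends c t|
    <= #|walk_ends c t.+1| + #|colored_partial_orderings c (inZp t)|.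
Proof.
rewrite -(cardsID (walk_ends c t.+1) (walk_ends c t)) leq_add //.
  by rewrite subset_leq_card // subsetIr.
rewrite -(card_in_imset (@drop_slot_lost_inj c t)) subset_leq_card //.
apply/subsetP => _ /imsetP[x /setDP[xt _] ->].
have /colored_orderingsP[x_inj _ cx] := subsetP (walk_ends_sub c t) x xt.
rewrite !inE; apply/andP; split.
  by apply/injectiveP => i j; rewrite !ffunE => /x_inj /lift_inj.
by apply/forallP => i; rewrite ffunE cx.
Qed.

Lemma card_colored_orderings_le c k :
  ~~ contains_copy (tight_path k.+1 m.+1) H ->
  #|colored_orderings c|
    <= \sum_(t < k) #|colored_partial_orderings c (inZp t)|.
Proof.
move=> path_free; have no_end : walk_ends c k = set0.
  apply/setP => x; rewrite inE; apply: contraNF path_free.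
  by case/walk_endsP => X /walk_contains_copy.
suff lost t : #|colored_orderings c| <= #|walk_ends c t|
    + \sum_(i < t) #|colored_partial_orderings c (inZp i)|.
  by have := lost k; rewrite no_end cards0.
elim: t => [|t IHt]; first by rewrite big_ord0 addn0.
rewrite big_ord_recr addnCA addnC (leq_trans IHt) // leq_add2r.
exact: card_walk_ends_step.
Qed.

Definition kind_size (s : 'I_m.+1) : nat := #|[pred i | kind i == kind s]|.

Lemma kind_size_gt0 s : 0 < kind_size s.
Proof. by apply/card_gt0P; exists s; rewrite inE. Qed.

(* Number of pairs formed by an ordering of a given edge and a coloring of the
   vertices that it respects. *)
Definition colorings_per_edge : nat :=
  m.+1`! * ((\prod_s kind_size s) * m.+1 ^ (#|V| - m.+1)).

Lemma colorings_per_edge_gt0 : 0 < colorings_per_edge.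
Proof.
by rewrite !muln_gt0 fact_gt0 expn_gt0 prodn_gt0 // => s; apply: kind_size_gt0.
Qed.

Lemma sum_card_colored_orderings : uniform m.+1 H ->
  \sum_c #|colored_orderings c| = #|H| * colorings_per_edge.
Proof.
move=> H_unif; rewrite mulnA -card_edge_orderings //.
have edge_inj : edge_orderings m.+1 H \subset injections 'I_m.+1 V.
  by apply/subsetP => x /[!inE] /andP[].
have := sum_card_constrained (fun s i => kind i == kind s) edge_inj.
by rewrite !card_ord.
Qed.

Lemma sum_card_colored_partial_orderings s : m < #|V| ->
  kind_size s * (\sum_c #|colored_partial_orderings c s|)
    = 'C(#|V|, m) * colorings_per_edge.
Proof.
move=> lt_mV; rewrite /colorings_per_edge (bigD1_ord s) //=.
have := sum_card_constrained (fun j i => kind i == kind (lift s j))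
  (subxx (injections 'I_m V)).
rewrite card_inj_ffuns !card_ord -bin_ffact => ->.
by rewrite -(subnSK lt_mV) expnS factS /kind_size; ring.
Qed.

Local Open Scope ring_scope.

Theorem card_tight_path_free_le (R : numFieldType) k :
  uniform m.+1 H -> ~~ contains_copy (tight_path k.+1 m.+1) H ->
  #|H|%:R <= 'C(#|V|, m)%:R * \sum_(t < k) (kind_size (inZp t))%:R^-1 :> R.
Proof.
move=> H_unif path_free; have [lt_V|lt_mV] := ltnP #|V| m.+1.
  rewrite (uniform_eq0 H_unif lt_V) cards0.
  by rewrite mulr_ge0 ?sumr_ge0 // => t _; rewrite invr_ge0.
have N_gt0 : 0 < colorings_per_edge%:R :> R.
  by rewrite ltr0n colorings_per_edge_gt0.
have partialE s :
    ((\sum_c #|colored_partial_orderings c s|)%N%:R : R)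
    = 'C(#|V|, m)%:R * (kind_size s)%:R^-1 * colorings_per_edge%:R.
  have size_neq0 : (kind_size s)%:R != 0 :> R.
    by rewrite pnatr_eq0 -lt0n kind_size_gt0.
  apply: (mulfI size_neq0); rewrite -natrM.
  by rewrite sum_card_colored_partial_orderings // natrM; field.
rewrite -(ler_pM2r N_gt0) mulr_sumr mulr_suml.
under eq_bigr => t _ do rewrite -partialE.
rewrite -natrM -sum_card_colored_orderings // -natr_sum ler_nat exchange_big.
by apply: leq_sum => c _; apply: card_colored_orderings_le.
Qed.

End Regions.

Section Mate.
Variable m : nat.
Implicit Types s i : 'I_m.+1.

(* The other slot of the pair of [s], or [s] itself if [s] is alone. *)
Definition mate s : 'I_m.+1 := insubd s (if odd s then s.-1 else s.+1).

Lemma val_mate s :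
  mate s = (if odd s then s.-1 else if s == m :> nat then m else s.+1) :> nat.
Proof.
have lt_s := ltn_ord s; rewrite val_insubd /=.
case: (odd s); first by rewrite ifT //; lia.
by case: eqP => [eq_sm|neq_sm]; [rewrite ifN | rewrite ifT]; lia.
Qed.

Lemma eq_half_mate i s : (i./2 == s./2) = (i == s) || (i == mate s).
Proof.
rewrite -!val_eqE /= val_mate; have lt_i := ltn_ord i.
by case: (boolP (odd s)) => odd_s; [|case: (s =P m :> nat)]; lia.
Qed.

Lemma mate_fixed s : (mate s == s) = ~~ odd m && (s == m :> nat).
Proof. by rewrite -val_eqE /= val_mate; do ![case: ifP]; lia. Qed.

Lemma mateK : involutive mate.
Proof.
move=> s; apply: val_inj; have lt_s := ltn_ord s.
by rewrite /= !val_mate; do ![case: ifP]; lia.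
Qed.

Lemma odd_mate s : mate s != s -> odd (mate s) = ~~ odd s.
Proof. by rewrite -val_eqE /= val_mate; do ![case: ifP]; lia. Qed.

Lemma card_eq_half s : #|[pred i : 'I_m.+1 | i./2 == s./2]| = (mate s != s).+1.
Proof.
rewrite eq_sym -cards2; apply: eq_card => i.
by rewrite !inE eq_half_mate.
Qed.

End Mate.

(* [v] lies strictly inside the cyclic arc that goes upwards from [a] to [b]. *)
Definition between (a v b : nat) : bool :=
  [|| a < v < b, v < b < a | b < a < v].

Section Arc.
Variables n m : nat.
Implicit Types (x y : {ffun 'I_m.+1 -> 'I_n}) (s : 'I_m.+1) (v : 'I_n).

Definition arc x s v : bool :=
  if mate s == s then x s < v
  else if odd s then between (x (mate s)) v (x s)
  else between (x s) v (x (mate s)).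

Lemma arc_self x s : ~~ arc x s (x s).
Proof. by rewrite /arc /between; do ![case: ifP] => *; lia. Qed.

Lemma arc_mate x s v : arc x (mate s) v = arc x s v.
Proof.
rewrite /arc mateK eq_sym; have [->//|mate_neq] := eqVneq (mate s) s.
by rewrite odd_mate //; case: odd.
Qed.

Lemma eq_half_arc x s s' : s./2 = s'./2 -> arc x s =1 arc x s'.
Proof.
move/eqP; rewrite eq_half_mate => /orP[/eqP ->|/eqP ->] v //.
exact: arc_mate.
Qed.

Lemma arc_shrink_moved x y s : {in predC1 s, x =1 y} -> arc x s (y s) ->
  subpred (arc y s) (arc x s).
Proof.
move=> agree moved v; move: moved; rewrite /arc.
have [_|mate_neq] := eqVneq (mate s) s; first by lia.
by rewrite (agree _ mate_neq) /between; case: ifP => _; lia.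
Qed.

Lemma arc_shrink x y s s' : {in predC1 s, x =1 y} -> arc x s (y s) ->
  subpred (arc y s') (arc x s').
Proof.
move=> agree moved v; have [eq_half|] := eqVneq s'./2 s./2.
  by rewrite !(eq_half_arc _ eq_half); apply: arc_shrink_moved.
rewrite eq_half_mate negb_or => /andP[s'_neq s'_mate].
have mate_neq : mate s' != s by rewrite (can2_eq (@mateK m) (@mateK m)).
by rewrite /arc !agree.
Qed.

Lemma arc_total x y s : injective x -> injective y ->
  {in predC1 s, x =1 y} -> x s != y s -> arc x s (y s) || arc y s (x s).
Proof.
move=> x_inj y_inj agree; rewrite /arc -val_eqE /=.
have [_|mate_neq] := eqVneq (mate s) s; first by lia.
have x_neq : x (mate s) != x s :> nat by rewrite val_eqE (inj_eq x_inj).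
have y_neq : y (mate s) != y s :> nat by rewrite val_eqE (inj_eq y_inj).
by move: x_neq; rewrite (agree _ mate_neq) /between; case: ifP => _; lia.
Qed.

Lemma arc_shrinking_regions : shrinking_regions (fun s => s./2) arc.
Proof.
by split; [exact: arc_self | exact: eq_half_arc | exact: arc_shrink
          | exact: arc_total].
Qed.

End Arc.

Local Open Scope ring_scope.

Lemma sum_inv_kind_size_half (R : numFieldType) (m k : nat) :
  \sum_(t < k) (kind_size (fun s : 'I_m.+1 => s./2) (inZp t))%:R^-1
    = 2^-1 * (k%:R + (if odd m then 0 else (k %/ m.+1)%:R)) :> R.
Proof.
elim: k => [|k IHk]; first by rewrite big_ord0 div0n if_same addr0 mulr0.
rewrite big_ord_recr /= IHk /kind_size card_eq_half mate_fixed divnS //=.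
have -> : (m.+1 %| k.+1)%N = (k %% m.+1 == m)%N.
  rewrite /dvdn -addn1 -modnDml addn1.
  have := ltn_pmod k (ltn0Sn m); rewrite ltnS leq_eqVlt => /orP[/eqP ->|lt_m].
    by rewrite modnn !eqxx.
  by rewrite modn_small // (ltn_eqF lt_m).
case: (odd m) => /=; first by rewrite !addr0 -[k.+1%:R]natr1 mulrDr mulr1.
rewrite natrD -[k.+1%:R]natr1.
by case: eqP => _ /=; rewrite ?invr1; field.
Qed.

Lemma turan_ex_le (R : numDomainType) (n r : nat) (U : finType)
    (F : {set {set U}}) (B : R) : 0 <= B ->
  (forall H : {set {set 'I_n}},
     uniform r H -> ~~ contains_copy F H -> #|H|%:R <= B) ->
  (turan_ex n r F)%:R <= B.
Proof.
move=> B_ge0 leB; rewrite /turan_ex; elim/big_ind: _ => //.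
  by move=> a b; rewrite /maxn; case: ifP.
by move=> H /andP[]; apply: leB.
Qed.

Theorem theorem1p2 (n r k : nat) (hn : (1 <= n)%N) (hr : (2 <= r)%N)
    (hk : (1 <= k)%N) :
  ((turan_ex n r (tight_path k r))%:R : rat) <=
    if ~~ odd r then (k%:R - 1) / 2%:R * 'C(n, r - 1)%:R
    else 1 / 2%:R * (k%:R + ((k - 1) %/ r)%:R) * 'C(n, r - 1)%:R.
Proof.
case: r hr => // m _; case: k hk => // k _.
apply: turan_ex_le => [|H H_unif path_free]; rewrite !subn1 /=.
  by case: ifP => _; rewrite -[k.+1%:R]natr1 ?addrK !mulr_ge0 ?addr_ge0.
have := card_tight_path_free_le (arc_shrinking_regions n m) rat
  H_unif path_free.
rewrite card_ord sum_inv_kind_size_half mulrC => /le_trans; apply.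
rewrite -[k.+1%:R]natr1; case: (odd m) => /=.
  by rewrite addr0 addrK [_ / _]mulrC.
by rewrite ler_wpM2r // mul1r ler_wpM2l // lerD2r lerDl.
Qed.
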